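(* Let $q$ be a prime power, $P \in \mathbb{F}_q[x]$ a monic irreducible polynomial, $k \geq 1$, and $D = \{P^{k_1}, \ldots, P^{k_s}\}$ with $0 \leq k_1 < k_2 < \cdots < k_s < k$. Let $g \in \mathbb{F}_q[x]/P^k$ and $P^t = \gcd(P^k, g)$. Then $$\lambda_g(P^k, D) = \lambda_{P^t}(P^k, D) = -\chi(P^k, D, t)|P|^t + \sum_{k_i \geq k-t} \varphi(P^{k-k_i}) = -\chi(P^k, D, t)|P|^t + (|P|-1)\sum_{k_i \geq k-t} |P|^{k-k_i-1},$$ where the sums run over those $i \in \{1,\ldots,s\}$ with $k_i \geq k-t$.
   Context: $|P| = q^{\deg P}$ and $\varphi(h) = |(\mathbb{F}_q[x]/h)^\times|$. The function $\chi$ is defined by $\chi(P^k,D,t) = 1$ if $k_i = k-t-1$ for some $1 \leq i \leq s$, and $\chi(P^k,D,t) = 0$ otherwise. For a monic $f$ and a set $D$ of monic divisors of $f$ with $f \notin D$, $\lambda_g(f,D) = \sum_{d \in D} c(g, f/d)$ for $g\in \mathbb{F}_q[x]/f$; these numbers (over all $g \in \mathbb{F}_q[x]/f$) are the eigenvalues, with multiplicity, of the gcd-graph $G_f(D)$ (vertex set $\mathbb{F}_q[x]/f$, with $a,b$ adjacent iff $\gcd(a-b,f) \in D$). Ramanujan sums: let $p$ be the characteristic of $\mathbb{F}_q$, $\zeta_p$ a primitive $p$-th root of unity, and $\mathrm{Tr}:\mathbb{F}_q \to \mathbb{F}_p$ the trace map. For a monic polynomial $h$ and $g \in \mathbb{F}_q[x]$,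 set $c(g,h) = \sum_{a \in (\mathbb{F}_q[x]/h)^{\times}} \zeta_p^{\mathrm{Tr}(\psi(ga))}$, where $\psi: \mathbb{F}_q[x]/h \to \mathbb{F}_q$ is a non-degenerate $\mathbb{F}_q$-linear functional (its kernel contains no nonzero ideal). The value does not depend on the choice of $\psi$; it is known that $c(g,h) = \mu(u)\varphi(h)/\varphi(u)$ with $u = h/\gcd(g,h)$, where $\mu$ is the Möbius function on monic polynomials ($\mu(u)=(-1)^r$ if $u$ is a product of $r$ distinct monic irreducibles, and $\mu(u)=0$ if $u$ is not squarefree). *)

(* Defs.v *)
From mathcomp Require Import all_boot all_order all_algebra all_field.
From mathcomp Require Import finmap.

Set Implicit Arguments.
Unset Strict Implicit.
Unset Printing Implicit Defensive.

Import GRing.Theory.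
Local Open Scope ring_scope.

(* The type {poly %/ h} is F[x]/h whenever h is monic and nonconstant; for any
   other h the library substitutes 'X for h.  The moduli h = f/d occurring in
   [gcd_eigenvalue] are nonconstant because f is not in D. *)

Section RamanujanSums.

Variable F : finFieldType.

Definition pnorm (P : {poly F}) : nat := #|F| ^ (size P).-1.

Definition ptotient (h : {poly F}) : nat :=
  #|[pred u : {poly %/ h} | u \is a GRing.unit]|.

(* Kernel contains no nonzero ideal. The improper ideal must be allowed here
   (it rules out psi = 0 when h is irreducible), so the library's
   [idealr_closed], which describes proper ideals, is not suitable. *)
Definition nondegenerate_functional (h : {poly F}) (psi : {poly %/ h} -> F) : Prop :=
  forall I : {pred {poly %/ h}},
    [/\ 0 \in I,
        {in I &, forall u v, u + v \in I}
      & forall a, {in I, forall u, a * u \in I}] ->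
    {in I, forall u, psi u = 0} ->
    {in I, forall u, u = 0}.

Section WithCharacteristic.

Variables (p : nat) (charFp : p \in [pchar F]).

(* [pPrimeCharType charFp] is F seen as a field extension of 'F_p. The Galois
   trace is an element of F lying in the prime field; [ftrace a] is the unique
   element of 'F_p whose image in F it is. *)
Definition ftrace (a : F) : 'F_p :=
  let L := pPrimeCharType charFp in
  odflt 0 [pick n : 'F_p | n%:A == galTrace 1 {:L} (a : L) :> L].

Variables (C : numClosedFieldType) (zeta : C).
Variable psi : forall h : {poly F}, {scalar {poly %/ h}}.

Definition ramanujan_sum (g h : {poly F}) : C :=
  \sum_(a : {poly %/ h} | a \is a GRing.unit)
     zeta ^+ (ftrace (psi h (in_qpoly h g * a)) : nat).

(* The class g is passed to the Ramanujan sums through its representative of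
   degree < deg f; since f/d divides f, its class modulo f/d depends only on
   the class g. *)
Definition gcd_eigenvalue (f : {poly F}) (D : {fset {poly F}})
    (g : {poly %/ f}) : C :=
  \sum_(d <- D) ramanujan_sum (g : {poly F}) (f %/ d).

End WithCharacteristic.

End RamanujanSums.

Definition prime_powers (F : finFieldType) (P : {poly F}) (s : nat)
    (ks : 'I_s -> nat) : {fset {poly F}} :=
  [fset P ^+ ks i | i in 'I_s]%fset.

(* The condition k_i = k - t - 1 is written additively: for t = k it must fail,
   whereas truncated subtraction would give 0. *)
Definition chi (s : nat) (ks : 'I_s -> nat) (k t : nat) : nat :=
  [exists i : 'I_s, ks i + t + 1 == k]%N.

(* Main.v *)
Require Import Defs.
From mathcomp Require Import all_boot all_order all_algebra all_field.
From mathcomp Require Import finmap zify.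

Set Implicit Arguments.
Unset Strict Implicit.
Unset Printing Implicit Defensive.

Import GRing.Theory.
Local Open Scope ring_scope.

(* Write e for the additive character u |-> zeta ^+ Tr (psi u) of F[x]/P^m.
   Since psi kills no nonzero ideal and the trace is not identically zero, the
   sum of e (g * a) over a in an ideal J vanishes unless g * J = 0.  The units
   are the complement of the ideal (P), so c(g, P^m) is the difference of the
   sums over F[x]/P^m and over (P).  If P^t is the exact power of P in g, this
   gives phi(P^m) for m <= t, - |(P)| = - |P|^t for m = t + 1, and 0 for
   m > t + 1; the eigenvalue is the sum of these over m = k - k_i. *)

(** Distinct automorphisms are linearly independent as characters; the trace is their combination
    with all coefficients 1. *)
Lemma galTrace_neq0 (F : fieldType) (L : splittingFieldType F)
    (K E : {subfield L}) :
  exists2 a, a \in E & galTrace K E a != 0.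
Proof.
have [a Ea sum_a] := @gal_independent_contra _ _ E [in 'Gal(E / K)%g]
  (fun=> 1) 1%g (fingroup.group1 _) (oner_neq0 _).
exists a => //; rewrite /galTrace; under eq_bigr do rewrite -[_ a]mul1r.
exact: sum_a.
Qed.

(** * The trace to the prime field *)

Section FieldTrace.

Variables (F : finFieldType) (p : nat) (charFp : p \in [pchar F]).
Local Notation L := (pPrimeCharType charFp).

Lemma ftraceE (a : F) :
  (ftrace charFp a)%:A = galTrace 1 {:L} (a : L) :> L.
Proof.
rewrite /ftrace; case: pickP => [n /eqP //|no_n].
(* [F] is Galois over its prime field, so the trace lies there and the default 0 in [ftrace] is
   never taken. *)
have galL : galois 1 {:L} := finField_galois (sub1v {:L}).
have /vlineP[n Dn] := mem_galTrace galL (memvf (a : L)).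
by have := no_n n; rewrite Dn eqxx.
Qed.

Lemma ftraceD : {morph ftrace charFp : a b / a + b}.
Proof.
move=> a b; apply: (fmorph_inj (in_alg L)) => /=.
by rewrite scalerDl !ftraceE raddfD.
Qed.

Lemma ftrace_neq0 : exists a, ftrace charFp a != 0.
Proof.
have [a _ trace_a] := galTrace_neq0 1 {:L}.
exists a; apply: contra_neq trace_a => trace0.
by rewrite -ftraceE trace0 scale0r.
Qed.

End FieldTrace.

(** * Additive characters of the quotient ring *)

Section AdditiveCharacter.

Variables (F : finFieldType) (p : nat) (charFp : p \in [pchar F]).
Variables (C : numClosedFieldType) (zeta : C).
Hypothesis zetaP : p.-primitive_root zeta.
Variables (h : {poly F}) (psi : {scalar {poly %/ h}}).
Hypothesis psiP : nondegenerate_functional psi.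

Definition additive_character (u : {poly %/ h}) : C :=
  zeta ^+ (ftrace charFp (psi u) : nat).
Local Notation e := additive_character.

Let p_prime : prime p. Proof. exact: pcharf_prime charFp. Qed.

Lemma additive_characterD u v : e (u + v) = e u * e v.
Proof.
rewrite /e raddfD ftraceD -exprD -[RHS](prim_expr_mod zetaP).
by congr (_ ^+ (_ %% _)); rewrite Fp_cast.
Qed.

Lemma additive_character0 : e 0 = 1.
Proof.
rewrite /e raddf0; suff -> : ftrace charFp 0 = 0 by rewrite expr0.
by apply: (addrI (ftrace charFp 0)); rewrite -ftraceD !addr0.
Qed.

Lemma additive_character_eq1 u : e u = 1 -> ftrace charFp (psi u) = 0.
Proof.
move/eqP; rewrite /e -(prim_order_dvd zetaP) => /dvdnP[n Dn].
(* The order [p] of [zeta] divides a representative smaller than [p], which is therefore 0. *)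
apply/val_inj => /=; case: n Dn => [|n] // Dn.
have := ltn_ord (ftrace charFp (psi u)).
by rewrite {1}Dn [X in (_ < X)%N]Fp_cast // mulSn ltnNge leq_addr.
Qed.

(* If the character were trivial on the ideal G * J while psi took a nonzero
   value there, then, G * J being stable under F, the trace would vanish. *)
Lemma additive_character_nontrivial (J : {pred {poly %/ h}}) (G : {poly %/ h}) :
    [/\ 0 \in J, {in J &, forall u v, u + v \in J}
      & forall a, {in J, forall u, a * u \in J}] ->
    (exists2 a, a \in J & G * a != 0) ->
  exists2 a, a \in J & e (G * a) != 1.
Proof.
case=> J0 JD JM [b Jb Gb_neq0].
have [/'exists_andP[a [Ja ea]]|] :=
  boolP [exists a, (a \in J) && (e (G * a) != 1)].
  by exists a.
rewrite negb_exists => /forallP e1; case/eqP: Gb_neq0.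
have {}e1 a : a \in J -> e (G * a) = 1.
  by move=> Ja; have := e1 a; rewrite Ja negbK => /eqP.
apply: (psiP (I := [pred v | [exists a in J, v == G * a]])).
- split=> [|u v|c u] /=; rewrite ?inE.
  + by apply/exists_inP; exists 0; rewrite ?mulr0.
  + move=> /exists_inP[x Jx /eqP->] /exists_inP[y Jy /eqP->].
    by apply/exists_inP; exists (x + y); rewrite ?JD ?mulrDr.
  + move=> /exists_inP[x Jx /eqP->].
    by apply/exists_inP; exists (c * x); rewrite ?JM // mulrCA.
- move=> u /exists_inP[a Ja /eqP->]; apply/eqP/negPn/negP => psi_neq0.
  have [x] := ftrace_neq0 charFp; case/eqP.
  (* With [c = x / psi (G * a)], linearity gives [x = psi (G * (c%:A * a))], and [c%:A * a] is still
     in [J]. *)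
  rewrite -(divfK psi_neq0 x) -linearZ -mulr_algl mulrCA.
  by apply: additive_character_eq1; apply/e1/JM.
by apply/exists_inP; exists b.
Qed.

(** Translating by some [b] in [J] with [e (G * b) != 1] permutes [J] and multiplies the sum by
    [e (G * b)], which forces it to vanish. *)
Lemma sum_additive_character (J : {pred {poly %/ h}}) (G : {poly %/ h}) :
    [/\ 0 \in J, {in J &, forall u v, u + v \in J}
      & forall a, {in J, forall u, a * u \in J}] ->
    (exists2 a, a \in J & G * a != 0) ->
  \sum_(a in J) e (G * a) = 0.
Proof.
move=> idJ /(additive_character_nontrivial idJ)[b Jb eb].
have [J0 JD JM] := idJ.
have JDr a : (a + b \in J) = (a \in J).
  apply/idP/idP=> Ja; last exact: JD.
  by rewrite -(addrK b a) -mulN1r; apply/JD/JM.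
apply/eqP; move: eb; apply: contraNT => sum_neq0; apply/eqP/(mulIf sum_neq0).
rewrite mul1r [in RHS](reindex_inj (addIr b)) mulr_sumr /=.
by apply: eq_big => [a|a _]; rewrite ?JDr // mulrDr additive_characterD mulrC.
Qed.

End AdditiveCharacter.

(** * Units and multiples of [P] modulo a power of [P] *)

Section PrimePowerModulus.

Variables (F : finFieldType) (P : {poly F}).
Hypotheses (Pmonic : P \is monic) (Pirr : irreducible_poly P).

Let size_P_gt1 : (1 < size P)%N. Proof. by case: Pirr. Qed.
Let P_neq0 : P != 0. Proof. exact: monic_neq0. Qed.

Lemma size_prime_power_gt1 m : (0 < m)%N -> (1 < size (P ^+ m))%N.
Proof.
move=> m_gt0; rewrite -ltn_predRL size_exp muln_gt0 m_gt0 andbT.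
by rewrite ltn_predRL.
Qed.

Lemma mk_monic_prime_power m : (0 < m)%N -> mk_monic (P ^+ m) = P ^+ m.
Proof. by move=> m_gt0; rewrite /mk_monic size_prime_power_gt1 ?monic_exp. Qed.

Lemma in_qpoly_prime_power m (f : {poly F}) :
  (0 < m)%N -> in_qpoly (P ^+ m) f = f %% P ^+ m :> {poly F}.
Proof.
move=> m_gt0; rewrite /= mk_monic_prime_power //.
by rewrite Pdiv.IdomainMonic.modpE ?monic_exp.
Qed.

Lemma in_qpoly_prime_power_eq0 m (f : {poly F}) :
  (0 < m)%N -> (in_qpoly (P ^+ m) f == 0) = (P ^+ m %| f).
Proof. by move=> m_gt0; rewrite /dvdp -in_qpoly_prime_power. Qed.

Lemma qpoly_prime_power_unit m (u : {poly %/ P ^+ m}) :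
  (0 < m)%N -> (u \is a GRing.unit) = ~~ (P %| (u : {poly F})).
Proof.
move=> m_gt0.
(* By conversion: invertibility in the quotient is coprimality of the representative to the
   modulus. *)
have -> : (u \is a GRing.unit) =
  coprimep (mk_monic (P ^+ m)) (u : {poly F}) by [].
move: (u : {poly F}) => f; rewrite mk_monic_prime_power //.
by rewrite coprimep_pexpl // irreducible_poly_coprime.
Qed.

(** Since [P] divides the modulus, reduction preserves divisibility by [P]; this makes the multiples
    of [P] an ideal. *)
Lemma dvdp_qpolyM m (u v : {poly %/ P ^+ m}) :
    (0 < m)%N -> P %| (v : {poly F}) ->
  P %| ((u * v : {poly %/ P ^+ m}) : {poly F}).
Proof.
move=> m_gt0 Pv; rewrite [X in P %| X](in_qpoly_prime_power _ m_gt0).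
by rewrite -dvdp_mod ?dvdp_mull // -{1}[P]expr1 dvdp_exp2l.
Qed.

(** Multiplication by [P] is a bijection from polynomials of size at most [n - deg P] onto the set
    counted. If [n < deg P], both sides contain only 0, in agreement with truncated subtraction. *)
Lemma card_dvd_npoly n :
  #|[pred u : {poly_n F} | P %| (u : {poly F})]| = (#|F| ^ (n - (size P).-1))%N.
Proof.
set d := (size P).-1.
have size_PM (v : {poly F}) : v != 0 -> size (v * P) = (size v + d)%N.
  move=> v_neq0; rewrite size_Mmonic // -subn1 -addnBA ?subn1 //.
  exact: ltnW.
have size_Pv (v : {poly_(n - d) F}) : (size ((v : {poly F}) * P)%R <= n)%N.
  have [->|v_neq0] := eqVneq (v : {poly F}) 0.
    by rewrite mul0r size_poly0.
  rewrite size_PM //.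
  have := size_npoly v; move: v_neq0; rewrite -size_poly_gt0; lia.
rewrite -card_npoly.
set f := fun v : {poly_(n - d) F} => npolyp n ((v : {poly F}) * P).
have f_inj : injective f.
  move=> v w /(congr1 (@polyn _ _)); rewrite !npolypK // => /(mulIf P_neq0).
  exact: val_inj.
rewrite -(card_codom f_inj); apply: eq_card => u; rewrite inE.
apply/idP/codomP => [/dvdpP[v Dv]|[v ->]]; last first.
  by rewrite /f npolypK ?dvdp_mulIr.
have size_v : (size v <= n - d)%N.
  have [->|v_neq0] := eqVneq v 0; first by rewrite size_poly0.
  by have := leq_sub2r d (size_npoly u); rewrite Dv size_PM // addnK.
exists (NPoly size_v); apply: val_inj.
by rewrite [RHS]npolypK /= -Dv ?size_npoly.
Qed.

Lemma card_dvd_qpoly_prime_power m : (0 < m)%N ->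
  #|[pred u : {poly %/ P ^+ m} | P %| (u : {poly F})]| = (pnorm P ^ m.-1)%N.
Proof.
move=> m_gt0; rewrite card_dvd_npoly mk_monic_prime_power // size_exp.
by rewrite -[m in LHS]prednK // mulnS addKn expnM.
Qed.

(** Units and multiples of [P] partition the ring. The additive form avoids subtraction in [nat]. *)
Lemma ptotient_prime_power m : (0 < m)%N ->
  (ptotient (P ^+ m) + pnorm P ^ m.-1 = pnorm P ^ m)%N.
Proof.
move=> m_gt0; rewrite -card_dvd_qpoly_prime_power // [in RHS]/pnorm -expnM.
rewrite -size_exp -card_monic_qpoly ?size_prime_power_gt1 ?monic_exp //.
rewrite -(cardC [pred u : {poly %/ P ^+ m} | P %| (u : {poly F})]) addnC.
by congr (_ + _)%N; apply: eq_card => u; rewrite !inE /= qpoly_prime_power_unit.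
Qed.

Lemma ptotient_prime_power_natr (C : numClosedFieldType) m : (0 < m)%N ->
  (ptotient (P ^+ m))%:R = ((pnorm P)%:R - 1) * (pnorm P)%:R ^+ m.-1 :> C.
Proof.
move=> m_gt0; apply: (addIr ((pnorm P)%:R ^+ m.-1)).
rewrite mulrBl mul1r subrK -exprS prednK // -!natrX -natrD.
by rewrite ptotient_prime_power.
Qed.

End PrimePowerModulus.

(** * Ramanujan sums and eigenvalues at prime powers *)

Section RamanujanSumPrimePower.

Variables (F : finFieldType) (p : nat) (charFp : p \in [pchar F]).
Variables (C : numClosedFieldType) (zeta : C).
Hypothesis zetaP : p.-primitive_root zeta.
Variable psi : forall h : {poly F}, {scalar {poly %/ h}}.
Hypothesis psiP : forall h : {poly F}, h \is monic -> (1 < size h)%N ->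
  nondegenerate_functional (psi h).
Variables (P : {poly F}).
Hypotheses (Pmonic : P \is monic) (Pirr : irreducible_poly P).

(** Exactness of [t] is asked only for [t < m]: when the eigenvalue is computed with [t = k], the
    representative [g] is 0 and every power of [P] divides it. *)
Lemma ramanujan_sum_prime_power (g : {poly F}) t m :
    (0 < m)%N -> P ^+ t %| g -> ((t < m)%N -> ~~ (P ^+ t.+1 %| g)) ->
  ramanujan_sum charFp zeta psi g (P ^+ m) =
    if (m <= t)%N then (ptotient (P ^+ m))%:R
    else - ((m == t.+1)%:R * (pnorm P)%:R ^+ t).
Proof.
move=> m_gt0 Pt_g Pt1_g; set h := P ^+ m; set G := in_qpoly h g.
rewrite /ramanujan_sum -/G.
pose e := additive_character charFp zeta (psi h).
have e_1 a : G * a = 0 -> e (G * a) = 1.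
  by move=> ->; apply: additive_character0.
have G_eq0 f : (G * in_qpoly h f == 0) = (h %| g * f).
  by rewrite -in_qpolyM in_qpoly_prime_power_eq0.
case: ifPn => [m_le_t|]; last rewrite -ltnNge => t_lt_m.
  have G0 : G = 0.
    apply/eqP; rewrite in_qpoly_prime_power_eq0 //.
    by apply: dvdp_trans Pt_g; apply: dvdp_exp2l.
  rewrite (eq_bigr (fun=> 1)) => [|a _]; last by apply: e_1; rewrite G0 mul0r.
  by rewrite sumr_const.
have nondeg : nondegenerate_functional (psi h).
  by apply: psiP; rewrite ?monic_exp ?size_prime_power_gt1.
pose J := [pred a : {poly %/ h} | P %| (a : {poly F})].
have idealT : [/\ 0 \in {poly %/ h},
    {in {poly %/ h} &, forall u v, u + v \in {poly %/ h}}
  & forall a, {in {poly %/ h}, forall u, a * u \in {poly %/ h}}] by [].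
have idealJ : [/\ 0 \in J, {in J &, forall u v, u + v \in J}
    & forall a, {in J, forall u, a * u \in J}].
  split=> [|u v|a u]; rewrite !inE; first exact: dvdp0.
    exact: dvdp_add.
  exact: dvdp_qpolyM.
have sumT : \sum_(a in {poly %/ h}) e (G * a) = 0.
  apply: sum_additive_character => //; exists 1 => //.
  rewrite -in_qpoly1 G_eq0 mulr1.
  by apply: contra (Pt1_g t_lt_m); apply/dvdp_trans/dvdp_exp2l.
have sumJ : \sum_(a in J) e (G * a) = (m == t.+1)%:R * (pnorm P)%:R ^+ t.
  case: eqVneq => [Dm|m_neq]; rewrite ?mul1r ?mul0r; last first.
    (* Here [m >= t + 2]. The class of [P] is a witness: [P ^+ m %| g * P] would give
       [P ^+ m.-1 %| g], hence [P ^+ t.+1 %| g]. *)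
    apply: sum_additive_character => //; exists (in_qpoly h P).
      rewrite inE in_qpoly_prime_power // -dvdp_mod //.
      by rewrite -{1}[P]expr1 dvdp_exp2l.
    rewrite G_eq0 /h -(prednK m_gt0) exprSr.
    rewrite (dvdp_mul2r _ _ (monic_neq0 Pmonic)).
    apply: contra (Pt1_g t_lt_m); apply/dvdp_trans/dvdp_exp2l.
    by lia.
  (* For [m = t + 1], [G] annihilates [J], so the sum is the cardinality of [J]. *)
  rewrite (eq_bigr (fun=> 1)) => [|a Ja].
    by rewrite sumr_const card_dvd_qpoly_prime_power // Dm natrX.
  apply/e_1/eqP; have -> : a = in_qpoly h (a : {poly F}).
    by apply/esym/val_inj/in_qpoly_small/size_mk_monic.
  have Dh : h = P ^+ t * P by rewrite /h Dm exprSr.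
  by rewrite G_eq0 [X in X %| _]Dh dvdp_mul.
apply/eqP; rewrite -sumJ -addr_eq0 -[X in _ == X]sumT [X in _ == X](bigID J).
rewrite addrC; apply/eqP; congr (_ + _); apply: eq_bigl => a; rewrite ?inE //=.
by rewrite qpoly_prime_power_unit.
Qed.

Lemma gcd_eigenvalue_prime_power k s (ks : 'I_s -> nat)
    (g : {poly %/ P ^+ k}) t :
    (forall i j : 'I_s, (i < j)%N -> (ks i < ks j)%N) ->
    (forall i : 'I_s, (ks i < k)%N) ->
    gcdp (P ^+ k) (g : {poly F}) %= P ^+ t ->
  gcd_eigenvalue charFp zeta psi (prime_powers P ks) g =
    - ((chi ks k t)%:R * (pnorm P)%:R ^+ t)
    + \sum_(i < s | (k - t <= ks i)%N) (ptotient (P ^+ (k - ks i)))%:R.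
Proof.
move=> ks_incr ks_lt gcd_g.
have size_P_gt1 : (1 < size P)%N by case: Pirr.
have Pexp_dvd a b : (P ^+ a %| P ^+ b) = (a <= b)%N by apply: dvdp_Pexp2l.
have ks_inj : injective ks.
  move=> i j Dij.
  by case: (ltngtP i j) => [/ks_incr|/ks_incr|/val_inj //]; rewrite Dij ltnn.
(* Distinct indices give distinct divisors, so the sum over the set [D] becomes a sum over
   indices. *)
have Pks_inj : injective (fun i => P ^+ ks i).
  by move=> i j Dij; apply/ks_inj/eqP; rewrite eqn_leq -!Pexp_dvd Dij dvdpp.
have dvd_g a : (a <= k)%N -> (P ^+ a %| (g : {poly F})) = (a <= t)%N.
  move=> a_le_k.
  by rewrite -Pexp_dvd -(eqp_dvdr _ gcd_g) dvdp_gcd Pexp_dvd a_le_k.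
have t_le_k : (t <= k)%N.
  by rewrite -Pexp_dvd -(eqp_dvdl _ gcd_g) dvdp_gcdl.
rewrite /gcd_eigenvalue /prime_powers big_imfset /=; last first.
  by move=> i j _ _; apply: Pks_inj.
rewrite big_enum /=.
rewrite (eq_bigr (fun i =>
    if (k - t <= ks i)%N then (ptotient (P ^+ (k - ks i)))%:R
    else - ((ks i + t + 1 == k)%N%:R * (pnorm P)%:R ^+ t))); last first.
  move=> i _; have := ks_lt i => ks_lt_k.
  have -> : P ^+ k %/ P ^+ ks i = P ^+ (k - ks i).
    by rewrite -{1}(subnK (ltnW ks_lt_k)) exprD mulpK ?expf_neq0 ?monic_neq0.
  rewrite (@ramanujan_sum_prime_power _ t).
  - have -> : (k - ks i <= t)%N = (k - t <= ks i)%N by lia.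
    by have -> : (k - ks i == t.+1)%N = (ks i + t + 1 == k)%N by lia.
  - by rewrite subn_gt0.
  - by rewrite dvd_g.
  (* From [t < k - ks i] follows [t.+1 <= k], the range where [dvd_g] applies. *)
  - by move=> t_lt; rewrite dvd_g ?ltnn //; lia.
rewrite (bigID (fun i => (k - t <= ks i)%N)) /= addrC.
congr (_ + _); last first.
  by apply: eq_bigr => i ->.
rewrite (eq_bigr (fun i =>
    - ((ks i + t + 1 == k)%N%:R * (pnorm P)%:R ^+ t))); last first.
  by move=> i /negPf->.
rewrite sumrN -mulr_suml; congr (- (_ * _)).
(* By injectivity of [ks] at most one index satisfies [ks i + t + 1 = k], so the sum of indicators
   is 0 or 1. Such an index has [ks i < k - t] and does belong to this half of the split. *)
rewrite /chi; case: existsP => [[i /eqP Di]|no_i].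
  rewrite (bigD1 i) /=; last by lia.
  rewrite Di eqxx big1 ?addr0 // => j /andP[_ j_neq_i].
  by case: eqP => // Dj; case/eqP: j_neq_i; apply: ks_inj; lia.
by apply: big1 => i _; case: eqP => // Di; case: no_i; exists i; apply/eqP.
Qed.

End RamanujanSumPrimePower.

Theorem theorem4p3 (F : finFieldType) (p : nat) (charFp : p \in [pchar F])
    (C : numClosedFieldType) (zeta : C) (zetaP : p.-primitive_root zeta)
    (psi : forall h : {poly F}, {scalar {poly %/ h}})
    (psiP : forall h : {poly F}, h \is monic -> (1 < size h)%N ->
       nondegenerate_functional (psi h))
    (P : {poly F}) (Pmonic : P \is monic) (Pirr : irreducible_poly P)
    (k : nat) (k_ge1 : (1 <= k)%N)
    (s : nat) (ks : 'I_s -> nat)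
    (ks_incr : forall i j : 'I_s, (i < j)%N -> (ks i < ks j)%N)
    (ks_lt : forall i : 'I_s, (ks i < k)%N)
    (g : {poly %/ P ^+ k}) (t : nat)
    (gcd_g : gcdp (P ^+ k) (g : {poly F}) %= P ^+ t) :
  let lambda := gcd_eigenvalue charFp zeta psi (prime_powers P ks) in
  [/\ lambda g = lambda (in_qpoly (P ^+ k) (P ^+ t)),
      lambda (in_qpoly (P ^+ k) (P ^+ t)) =
        - ((chi ks k t)%:R * (pnorm P)%:R ^+ t)
        + \sum_(i < s | (k - t <= ks i)%N) (ptotient (P ^+ (k - ks i)))%:R
    & - ((chi ks k t)%:R * (pnorm P)%:R ^+ t)
        + \sum_(i < s | (k - t <= ks i)%N) (ptotient (P ^+ (k - ks i)))%:R
      = - ((chi ks k t)%:R * (pnorm P)%:R ^+ t)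
        + ((pnorm P)%:R - 1) *
          \sum_(i < s | (k - t <= ks i)%N) (pnorm P)%:R ^+ (k - ks i - 1)
        :> C].
Proof.
move=> lambda.
have lambdaE := gcd_eigenvalue_prime_power charFp zetaP psiP Pmonic Pirr
  ks_incr ks_lt.
(* The representative of [P ^+ t] is its remainder modulo [P ^+ k], which is 0 when [t = k]; the gcd
   with [P ^+ k] is unaffected, so both classes share the same [t]. *)
have gcd_Pt : gcdp (P ^+ k) (in_qpoly (P ^+ k) (P ^+ t) : {poly F}) %= P ^+ t.
  rewrite in_qpoly_prime_power // (eqp_trans (gcdp_modr _ _)) //.
  by rewrite dvdp_gcd_idr // -(eqp_dvdl _ gcd_g) dvdp_gcdl.
split; rewrite /lambda ?(lambdaE _ _ gcd_g) ?(lambdaE _ _ gcd_Pt) //.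
congr (_ + _); rewrite mulr_sumr; apply: eq_bigr => i _.
by rewrite ptotient_prime_power_natr ?subn_gt0 // subn1.
Qed.
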